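(* Let $H$ be a real Hilbert space, $C$ a nonempty closed convex subset of $H$, $N$ a positive integer, $\Lambda = \{i \in \mathbb{N} : 1 \leq i \leq N\}$, and $T_i \colon C \to H$ a quasinonexpansive mapping for each $i \in \Lambda$. Let $F = \bigcap_{i \in \Lambda} \operatorname{F}(T_i)$ be the set of common fixed points of $\{T_i\}_{i \in \Lambda}$. Let $u \in H$, let $\{\alpha_n\}$ be a sequence in $(0,1]$ and $\{\beta_n\}$ a sequence in $(0,1)$, and let $\{x_n\}$ be a sequence defined by $x_1 \in C$ and $$ \begin{cases} i_n \in \arg\max \{ \lVert T_i x_n - x_n \rVert : i \in \Lambda \}; \\ x_{n+1} = P_C \Bigl( \alpha_n u + (1-\alpha_n) \bigl( \beta_n x_n + (1-\beta_n) T_{i_n} x_n \bigr) \Bigr) \end{cases} $$ for $n \in \mathbb{N}$ (where $i_n$ is any choice of an element of the indicated set). Suppose that $F$ is nonempty, $\hat{\operatorname{F}}(T_i) = \operatorname{F}(T_i)$ for all $i \in \Lambda$, $\sum_n \alpha_n = \infty$, $\lim_n \alpha_n = 0$, $\inf_n \beta_n > 0$, and $\sup_n \beta_n < 1$. Then $\{x_n\}$ converges strongly to $P_F(u)$.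
   Context: $\mathbb{N}$ is the set of positive integers. For a mapping $T \colon C \to H$ defined on a nonempty subset $C$ of $H$: - $\operatorname{F}(T) = \{z \in C : Tz = z\}$ is the set of fixed points of $T$. - A point $z \in C$ is an asymptotic fixed point of $T$ if there exists a sequence $\{y_n\}$ in $C$ such that $y_n - T y_n \to 0$ strongly and $y_n \rightharpoonup z$ (weak convergence). The set of asymptotic fixed points of $T$ is denoted by $\hat{\operatorname{F}}(T)$. - $T$ is quasinonexpansive if $\operatorname{F}(T) \neq \emptyset$ and $\lVert Tx - z\rVert \leq \lVert x - z\rVert$ for all $x \in C$ and $z \in \operatorname{F}(T)$. If $C$ is closed and convex and $T$ is quasinonexpansive, then $\operatorname{F}(T)$ is closed and convex. For a nonempty closed convex subset $D$ of $H$, $P_D$ denotes the metric projection of $H$ onto $D$: $P_D(x)$ is the unique point of $D$ with $\lVert x - P_D(x)\rVert = \min\{\lVert x-y\rVert : y \in D\}$. *)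

(* Defs.v *)
From HB Require Import structures.
From mathcomp Require Import all_boot all_order all_algebra.
From mathcomp Require Import all_classical all_reals all_analysis.

Set Implicit Arguments.
Unset Strict Implicit.
Unset Printing Implicit Defensive.

Import Order.TTheory GRing.Theory Num.Theory.
Import numFieldNormedType.Exports.

Local Open Scope classical_set_scope.
Local Open Scope ring_scope.

Section Notions.
Context {R : realType} {H : normedModType R}.
Implicit Types (C D : set H) (T : H -> H).

(* A mapping C -> H is encoded as a total function T : H -> H together with C:
   the notions below only look at the values of T on C. *)

Definition fixed_points C T : set H := [set z | C z /\ T z = z].

Definition weakly_cvg (y : nat -> H) (z : H) : Prop :=
  forall f : {linear H -> R^o}, continuous f -> f (y n) @[n --> \oo] --> f z.

Definition asymptotic_fixed_points C T : set H :=
  [set z | C z /\ exists y : nat -> H,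
    [/\ forall n, C (y n),
        y n - T (y n) @[n --> \oo] --> (0 : H) &
        weakly_cvg y z]].

Definition quasinonexpansive C T : Prop :=
  fixed_points C T !=set0 /\
  forall x z, C x -> fixed_points C T z -> `|T x - z| <= `|x - z|.

(* An unspecified point when x has no nearest point in D, which does not
   happen for D nonempty closed convex in a Hilbert space. *)
Definition metric_proj D (x : H) : H :=
  get [set p | D p /\ forall y, D y -> `|x - p| <= `|x - y|].

End Notions.

Definition argmax {R : realType} {I : Type} (f : I -> R) : set I :=
  [set i | forall j, f j <= f i].

(* Main.v *)
(** Write z = P_F u, let y_n be the point whose projection onto C is x_{n+1},
    and put s_n = |x_n - z|^2, D_n = |T_{i_n} x_n - x_n| and
    t_n = 2 <u - z, y_n - z>.  Quasinonexpansiveness gives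
      s_{n+1} <= (1 - a_n) s_n - (1 - a_n) b_n (1 - b_n) D_n^2 + a_n t_n.
    For every e > 0 there is d > 0 such that, for n large, s_n - s_{n+1} <= d
    implies t_n <= e: otherwise D_n -> 0 along a subsequence with t_n > e, a
    weak limit v of the x_n along it lies in F because the argmax controls all the
    T_j at once, and then <u - z, v - z> <= 0 is a contradiction.  Thus either
    s_n drops by d, which beats a_n s_n as a_n -> 0, or t_n <= e; in both cases
    s_{n+1} <= (1 - a_n) s_n + a_n e for n large, and s_n -> 0 follows from the
    divergence of the series of the a_n. *)

Require Import Defs.
From HB Require Import structures.
From mathcomp Require Import all_boot all_order all_algebra.
From mathcomp Require Import all_classical all_reals all_analysis.
From mathcomp Require Import ring lra.

Set Implicit Arguments.
Unset Strict Implicit.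
Unset Printing Implicit Defensive.

Import Order.TTheory GRing.Theory Num.Theory.
Import numFieldNormedType.Exports.

Local Open Scope classical_set_scope.
Local Open Scope ring_scope.

Lemma convex_set_combination (R : realType) (E : lmodType R) (D : set E) :
  convex_set (D : set (convex_lmodType E)) ->
  forall (p q : E) (t : R), 0 <= t <= 1 -> D p -> D q ->
  D (t *: p + (1 - t) *: q).
Proof.
move=> cD p q t t01 Dp Dq.
have t01' : Itv.spec (@Itv.num_sem R) (Itv.Real `[0%Z, 1%Z]) t.
  by rewrite /Itv.num_sem /= num_real in_itv.
have := cD p q (Itv.mk t01'); rewrite !inE; exact.
Qed.

(** * Inner product calculus *)

Section InnerProduct.
Context (R : realType) (H : normedModType R) (dot : {dot H for idfun}).
Hypothesis dot_norm : forall v : H, `|v| ^+ 2 = dot v v.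
Implicit Types (u v w : H).

Lemma dotC u v : dot u v = dot v u.
Proof. by rewrite hermC expr0 mul1r. Qed.

Lemma dotDl u v w : dot (u + v) w = dot u w + dot v w.
Proof. exact: linearDl. Qed.

Lemma dotDr u v w : dot u (v + w) = dot u v + dot u w.
Proof. by rewrite !(dotC u) dotDl. Qed.

Lemma dotZl a u v : dot (a *: u) v = a * dot u v.
Proof. exact: linearZl_LR. Qed.

Lemma dotZr a u v : dot u (a *: v) = a * dot u v.
Proof. by rewrite !(dotC u) dotZl. Qed.

Lemma dotNl u v : dot (- u) v = - dot u v.
Proof. by rewrite -scaleN1r dotZl mulN1r. Qed.

Lemma dotNr u v : dot u (- v) = - dot u v.
Proof. by rewrite !(dotC u) dotNl. Qed.

Definition dotE := (dotDl, dotDr, dotNl, dotNr, dotZl, dotZr).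

Lemma dot_ge0 u : 0 <= dot u u.
Proof. by rewrite -dot_norm exprn_ge0. Qed.

Lemma dot_eq0 u : dot u u = 0 -> u = 0.
Proof. by rewrite -dot_norm => /eqP; rewrite sqrf_eq0 normr_eq0 => /eqP. Qed.

Lemma ler_dot_norm u v : (dot u u <= dot v v) = (`|u| <= `|v|).
Proof. by rewrite -!dot_norm ler_sqr// nnegrE. Qed.

(** Cauchy-Schwarz: the squared norm of [dot v v *: u - dot u v *: v] is [dot v v] times the
    difference of the two squared sides. *)
Lemma dot_normM u v : `|dot u v| <= `|u| * `|v|.
Proof.
rewrite -ler_sqr ?nnegrE ?mulr_ge0// exprMn !dot_norm real_normK ?num_real//.
have [v0|v0] := eqVneq (dot v v) 0.
  by rewrite (dot_eq0 v0) (dotC u) -(scale0r v) !dotZl !mul0r mulr0 expr0n.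
have vgt0 : 0 < dot v v by rewrite lt_neqAle eq_sym v0 dot_ge0.
have := dot_ge0 (dot v v *: u - dot u v *: v).
rewrite !dotE (dotC v u) => h.
by rewrite -(ler_pM2l vgt0); nra.
Qed.

(** The subtracted term expresses strong convexity of the squared norm; in [halpern_step] it becomes
    the term that controls the residuals. *)
Lemma dot_combination (t : R) (p q : H) :
  dot (t *: p + (1 - t) *: q) (t *: p + (1 - t) *: q) =
  t * dot p p + (1 - t) * dot q q - t * (1 - t) * dot (p - q) (p - q).
Proof. by rewrite !dotE (dotC q p); ring. Qed.

Lemma cvg_dotl (I : Type) (F : set_system I) (FF : Filter F) (f : I -> H)
    (l v : H) :
  f @ F --> l -> dot (f i) v @[i --> F] --> dot l v.
Proof.
move=> fl; apply/cvgrPdistC_lt => e e0; near=> i.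
rewrite -dotNl -dotDl; apply: le_lt_trans (dot_normM _ _) _.
have v1 : 0 < `|v| + 1 by apply: ltr_wpDl.
have : `|f i - l| < e / (`|v| + 1).
  by near: i; apply: cvgr_distC_lt => //; rewrite divr_gt0.
rewrite ltr_pdivlMr//; apply: le_lt_trans.
by rewrite ler_wpM2l// lerDl.
Unshelve. all: by end_near. Qed.

Lemma closed_halfspace (v : H) (c : R) : closed [set z | dot z v <= c].
Proof.
rewrite (_ : [set _ | _] = (fun z => dot z v) @^-1` [set y | y <= c])//.
apply: preimage_closed; last exact: closed_le.
by move=> z _; apply: cvg_dotl cvg_id.
Qed.

End InnerProduct.

(** * Metric projection and Riesz representation *)

Section Projection.
Context (R : realType) (H : completeNormedModType R) (dot : {dot H for idfun}).
Hypothesis dot_norm : forall v : H, `|v| ^+ 2 = dot v v.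
Implicit Types (D S : set H) (x p q u v : H).

(** A minimising sequence is Cauchy by the parallelogram law: midpoints of its terms stay in [D], so
    their squared distance to [x] is at least [inf E]. *)
Lemma ex_nearest_point D x : D !=set0 -> closed D ->
  convex_set (D : set (convex_lmodType H)) ->
  exists p, D p /\ forall y, D y -> `|x - p| <= `|x - y|.
Proof.
move=> [y0 Dy0] Dcl /convex_set_combination Dcv.
pose E := [set dot (x - y) (x - y) | y in D].
have E0 : has_lbound E by exists 0 => _ [y _ <-]; exact: dot_ge0.
have infE : has_inf E by split=> //; exists (dot (x - y0) (x - y0)), y0.
have dP y : D y -> inf E <= dot (x - y) (x - y).
  by move=> Dy; apply: ge_inf => //; exists y.
have /choice[y yP] n : exists y, D y /\
    dot (x - y) (x - y) < inf E + n.+1%:R^-1.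
  have n0 : 0 < n.+1%:R^-1 :> R by rewrite invr_gt0.
  by have [_ [y Dy <-] lty] := inf_adherent n0 infE; exists y.
have y_dist n m :
    dot (y n - y m) (y n - y m) <= 2 * n.+1%:R^-1 + 2 * m.+1%:R^-1.
  have half01 : 0 <= (2^-1 : R) <= 1 by lra.
  have := dP _ (Dcv _ _ _ half01 (yP n).1 (yP m).1).
  have := (yP n).2; have := (yP m).2.
  move: (y n) (y m) n.+1%:R^-1 m.+1%:R^-1 => a b r s.
  by rewrite !dotE (dotC _ a x) (dotC _ b x) (dotC _ b a); lra.
have /cauchy_cvg/cvg_ex[l yl] : cauchy (y n @[n --> \oo]).
  apply/cauchy_exP => e e0.
  (* With both indices at least [N], each term of [y_dist] is below [e ^+ 2 / 2]. *)
  have e2 : 0 < e ^+ 2 / 4 by rewrite divr_gt0// exprn_gt0.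
  have [N _ Ne] := near_infty_natSinv_lt (PosNum e2).
  exists (y N), N => // n /= Nn; rewrite -ball_normE /ball_ /=.
  rewrite -ltr_sqr ?nnegrE// ?ltW// (dot_norm (y N - y n)).
  have h1 : N.+1%:R^-1 < e ^+ 2 / 4 := Ne _ (leqnn N).
  have h2 : n.+1%:R^-1 < e ^+ 2 / 4 := Ne _ Nn.
  by move: (y_dist N n) h1 h2; move: N.+1%:R^-1 n.+1%:R^-1 => r s; lra.
exists l; split.
  by apply: closed_cvg yl => //; apply: nearW => n; case: (yP n).
move=> z Dz; rewrite -(ler_dot_norm dot_norm); apply: le_trans (dP _ Dz).
rewrite -dot_norm.
apply: (@ler_cvg_to _ (nbhs \oo) _ R (fun n => `|x - y n| ^+ 2)
  (fun n => inf E + n.+1%:R^-1)).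
- have cx : `|x - y n| @[n --> \oo] --> `|x - l|.
    by apply: cvg_norm; apply: cvgB => //; exact: cvg_cst.
  by rewrite expr2; exact: (cvgM cx cx).
- rewrite -[X in _ --> X]addr0; apply: cvgD; first exact: cvg_cst.
  exact: cvg_harmonic.
- by apply: nearW => n; rewrite dot_norm ltW//; case: (yP n).
Qed.

(** The variational inequality, through which all later uses of [metric_proj] go. *)
Lemma metric_projP D x : D !=set0 -> closed D ->
  convex_set (D : set (convex_lmodType H)) ->
  D (metric_proj D x) /\
  forall y, D y -> dot (x - metric_proj D x) (y - metric_proj D x) <= 0.
Proof.
move=> D0 Dcl Dcv; have := ex_nearest_point x D0 Dcl Dcv.
rewrite /metric_proj; move/getPex; set p := get _ => -[Dp pmin].
split=> // y Dy; rewrite leNgt; apply/negP => c0.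
set c := dot _ _ in c0; set b := dot (y - p) (y - p).
have b0 : 0 <= b by exact: dot_ge0.
(* Moving from p towards y by t decreases the squared distance to x, as
   [t * b < 2 * c]. *)
pose t := c / (b + c).
have bc : 0 < b + c by rewrite ltr_wpDl.
have tbc : t * (b + c) = c by rewrite divfK// gt_eqF.
have t0 : 0 < t by rewrite divr_gt0.
have t01 : 0 <= t <= 1.
  by rewrite (ltW t0)/= /t ler_pdivrMr// mul1r lerDr.
have := pmin _ (convex_set_combination Dcv t01 Dy Dp).
rewrite -(ler_dot_norm dot_norm).
apply/negP; rewrite -ltNge.
have -> : dot (x - (t *: y + (1 - t) *: p)) (x - (t *: y + (1 - t) *: p)) =
  dot (x - p) (x - p) - 2 * t * c + t ^+ 2 * b.
  by rewrite /c /b !dotE (dotC _ y x) (dotC _ p x) (dotC _ p y); ring.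
nra.
Qed.

(** Split [x - q] as [(x - p) + (p - q)], with [p] the projection: the variational inequality makes
    the cross term nonnegative. *)
Lemma metric_proj_dist D x q : D !=set0 -> closed D ->
  convex_set (D : set (convex_lmodType H)) -> D q ->
  `|metric_proj D x - q| <= `|x - q|.
Proof.
move=> D0 Dcl Dcv Dq; have [_ /(_ _ Dq)] := metric_projP x D0 Dcl Dcv.
set p := metric_proj D x; rewrite -(ler_dot_norm dot_norm).
have := dot_ge0 dot_norm (x - p).
have -> : x - q = (x - p) + (p - q) by rewrite addrA subrK.
rewrite -(opprB p q); move: (x - p) (p - q) => r s.
by rewrite !dotE (dotC _ s r); lra.
Qed.

(** On a subspace the variational inequality can be tested at both [p + s] and [p - s], which turns
    it into an equality. *)
Lemma ex_orthogonal_proj S v : S 0 -> closed S ->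
  (forall a u w, S u -> S w -> S (a *: u + w)) ->
  exists2 p, S p & forall s, S s -> dot (v - p) s = 0.
Proof.
move=> S0 Scl Slin.
have Scv : convex_set (S : set (convex_lmodType H)).
  move=> u w t; rewrite !inE => Su Sw; apply: (Slin _ u) => //.
  by rewrite -[_ *: w]addr0; exact: (Slin _ w).
have [Sp pP] := metric_projP v (ex_intro _ 0 S0) Scl Scv.
exists (metric_proj S v) => // s Ss; move: Sp pP; set p := metric_proj S v.
move=> Sp pP; apply/eqP; rewrite eq_le.
have := pP _ (Slin 1 _ _ Ss Sp); have := pP _ (Slin (-1) _ _ Ss Sp).
by rewrite scale1r scaleN1r !addrK dotNr oppr_le0 => -> ->.
Qed.

(** If [e] is orthogonal to the kernel and [f e] is nonzero, every [v] differs from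
    [(f v / f e) *: e] by a kernel element; pairing with [e] recovers [f v]. *)
Lemma riesz_representation (f : H -> R) :
  (forall a u v, f (a *: u + v) = a * f u + f v) -> continuous f ->
  exists w, forall v, f v = dot v w.
Proof.
move=> flin fcont; pose K := [set v | f v = 0].
have f0 : f 0 = 0 by have := flin (-1) 0 0; rewrite scaleN1r addNr mulN1r addNr.
have [K0|/existsNP[v0 fv0]] := pselect (forall v, f v = 0).
  by exists 0 => v; rewrite K0 -(scale0r (0 : H)) dotZr mul0r.
have Kcl : closed K.
  rewrite (_ : K = f @^-1` [set 0])//.
  by apply: preimage_closed => [z _|]; [exact: fcont|exact: closed_eq].
have Klin a u w : K u -> K w -> K (a *: u + w).
  by rewrite /K/= flin => -> ->; rewrite mulr0 addr0.
have [p Kp pP] := ex_orthogonal_proj v0 f0 Kcl Klin.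
pose e := v0 - p.
have fe : f e = f v0.
  by rewrite /e addrC -scaleN1r flin (_ : f p = 0)// mulr0 add0r.
have e0 : dot e e != 0.
  apply/eqP => /(dot_eq0 dot_norm) e0; apply: fv0.
  by rewrite -fe e0.
have fe0 : f e != 0 by rewrite fe; exact/eqP.
exists ((f e / dot e e) *: e) => v.
have : K (- (f v / f e) *: e + v).
  by rewrite /K/= flin mulNr divfK// addNr.
move/pP; rewrite -/e dotDr dotZr (dotC _ e v) mulNr => /eqP.
rewrite addrC subr_eq0 dotZr => /eqP ->.
by field; rewrite fe0 e0.
Qed.

End Projection.

(** * Weak sequential compactness of bounded sequences *)

Section WeakCompactness.
Context (R : realType).

(** Compactness of the segment gives a cluster point, and an ultrafilter converges to each of its
    cluster points. *)
Lemma ultra_bounded_cvg (I : Type) (U : set_system I) (f : I -> R) (M : R) :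
  UltraFilter U -> (forall i, `|f i| <= M) ->
  exists l : R, f i @[i --> U] --> l.
Proof.
move=> UU fM; have UP := ultra_proper.
have [|l [_ lU]] := @segment_compact R (- M) M (f i @[i --> U]) _.
  by apply: (@nearW _ U) => i; rewrite /= in_itv/= -ler_norml.
exists l => B Bl; have [//|UB] := in_ultra_setVsetC (f @^-1` B) UU.
by have [y []] := lU _ _ (UB : (f i @[i --> U]) (~` B)) Bl.
Qed.

Context (H : completeNormedModType R) (dot : {dot H for idfun}).
Hypothesis dot_norm : forall v : H, `|v| ^+ 2 = dot v v.

(* An ultrafilter limit of the [dot (y n)], represented by z, gives indices
   [phi k] for which [y (phi k) - z] is almost orthogonal to the [y j - z],
   j <= k.  The vectors v with [dot (y (phi k) - z) v --> 0] then form a closed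
   subspace S containing all the [y j - z], and [v - P_S v] is orthogonal to
   these, hence lies in S as well: S is the whole space. *)
Lemma bounded_weak_subsequence (y : nat -> H) (M : R) :
  (forall n, `|y n| <= M) ->
  exists (phi : nat -> nat) (z : H),
    (forall k, (k <= phi k)%N) /\ weakly_cvg (y \o phi) z.
Proof.
move=> yM.
have M0 : 0 <= M by apply: le_trans (yM 0%N).
have [U [UU ooU]] := @ultraFilterLemma nat \oo _.
have UP := ultra_proper.
have /choice[f fP] : forall v, exists l : R, dot (y n) v @[n --> U] --> l.
  move=> v; apply: (ultra_bounded_cvg (M := M * `|v|)) => n.
  by apply: le_trans (dot_normM dot_norm _ _) _; rewrite ler_wpM2r.
have flin a u v : f (a *: u + v) = a * f u + f v.
  apply: (@norm_cvg_unique _ _ (dot (y n) (a *: u + v) @[n --> U])) => //=.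
  under eq_fun do rewrite dotDr dotZr.
  by apply: cvgD => //; apply: cvgMr.
have fM v : `|f v| <= M * `|v|.
  apply: (@ler_cvg_to _ U _ R (fun n => `|dot (y n) v|) (fun=> M * `|v|)).
  - exact: cvg_norm.
  - exact: cvg_cst.
  apply: nearW => n.
  by apply: le_trans (dot_normM dot_norm _ _) _; rewrite ler_wpM2r.
have fcont : continuous f.
  have M1 : 0 < M + 1 by lra.
  move=> v; apply/cvgrPdistC_lt => e e0; near=> w.
  have -> : f w - f v = f (w - v).
    by rewrite -[w - v]addrC -scaleN1r flin mulN1r addrC.
  apply: le_lt_trans (fM _) _.
  have : `|w - v| < e / (M + 1).
    near: w; apply: (@cvgr_distC_lt _ _ _ (nbhs v) _ id v cvg_id).
    by rewrite divr_gt0.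
  rewrite ltr_pdivlMr// mulrC; apply: le_lt_trans.
  by rewrite ler_wpM2r// lerDl.
have [z zP] := riesz_representation dot_norm flin fcont.
pose e n := y n - z.
have eU v : dot (e n) v @[n --> U] --> 0.
  rewrite -(subrr (dot z v)); under eq_fun do rewrite dotDl dotNl.
  by apply: cvgB; [rewrite dotC -zP|exact: cvg_cst].
(* Each of these finitely many conditions holds along [U], which also contains every tail, so some
   index meets them all. *)
have /choice[phi phiP] k : exists n, (k <= n)%N /\
    forall j : 'I_k.+1, `|dot (e n) (e j)| < k.+1%:R^-1.
  have k0 : 0 < k.+1%:R^-1 :> R by rewrite invr_gt0.
  apply: (@filter_ex _ U); apply: filterI.
    by apply: ooU; exact: nbhs_infty_ge.
  apply: filter_forall => j.
  exact: (cvgr0_norm_lt _ (eU (e j)) _ k0).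
exists phi, z; split=> [k|g gcont]; first by case: (phiP k).
pose S := [set v | dot (e (phi k)) v @[k --> \oo] --> 0].
have Sall v : S v.
  have Se j : S (e j).
    apply/cvgr0Pnorm_lt => r r0; near=> k.
    have jk : (j < k.+1)%N by near: k; apply: nbhs_infty_ge.
    have := (phiP k).2 (Ordinal jk); move/lt_trans; apply => /=.
    by near: k; exact: (near_infty_natSinv_lt (PosNum r0)).
  have S0 : S 0.
    rewrite /S/=; under eq_fun do rewrite -(scale0r (0 : H)) dotZr mul0r.
    exact: cvg_cst.
  have Slin a u w : S u -> S w -> S (a *: u + w).
    move=> Su Sw; rewrite /S/=; under eq_fun do rewrite dotDr dotZr.
    rewrite -(addr0 0) -{1}(mulr0 a).
    by apply: cvgD => //; apply: cvgMr.
  have Scl : closed S.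
    have eM n : `|e n| <= M + `|z|.
      by apply: le_trans (ler_normB _ _) _; rewrite lerD2r.
    have M1 : 0 < M + `|z| + 1 by rewrite ltr_wpDl ?addr_ge0.
    move=> v' v'S; apply/cvgr0Pnorm_lt => r r0.
    (* By Cauchy-Schwarz and [eM], replacing [v'] by a point of [S] this close changes the products
       by less than [r / 2]. *)
    have r1 : 0 < r / 2 / (M + `|z| + 1) by rewrite !divr_gt0.
    have [s [Ss]] := v'S _ (nbhsx_ballx v' _ r1).
    rewrite -ball_normE /ball_ /= ltr_pdivlMr// => vs.
    near=> k; rewrite -(subrK s v') dotDr.
    have -> : r = r / 2 + r / 2 by lra.
    apply: le_lt_trans (ler_normD _ _) _; apply: ltrD.
      apply: le_lt_trans (dot_normM dot_norm _ _) _.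
      apply: le_lt_trans vs; rewrite mulrC ler_wpM2l//.
      by apply: le_trans (eM _) _; rewrite lerDl.
    by near: k; apply: (cvgr0_norm_lt _ Ss); rewrite divr_gt0.
  have [p Sp pP] := ex_orthogonal_proj dot_norm v S0 Scl Slin.
  rewrite -(subrK p v) -(scale1r (v - p)); apply: Slin => //.
  rewrite /S/=; under eq_fun do rewrite dotC pP//.
  exact: cvg_cst.
have [w wP] : exists w, forall v, g v = dot v w.
  apply: (riesz_representation dot_norm) => // a u v.
  by rewrite linearP.
have gE : (fun n => g ((y \o phi) n)) =
    (fun n => dot (e (phi n)) w + dot z w).
  by apply/funext => n; rewrite /= wP -dotDl subrK.
have : dot (e (phi n)) w + dot z w @[n --> \oo] --> 0 + dot z w.
  by apply: cvgD; [exact: Sall|exact: cvg_cst].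
by rewrite add0r gE wP.
Unshelve. all: by end_near. Qed.

End WeakCompactness.

(** * Weak limits and fixed point sets *)

Section WeakLimits.
Context (R : realType) (H : completeNormedModType R) (dot : {dot H for idfun}).
Hypothesis dot_norm : forall v : H, `|v| ^+ 2 = dot v v.

Lemma weakly_cvg_dot (y : nat -> H) (z w : H) :
  weakly_cvg y z -> dot (y n) w @[n --> \oo] --> dot z w.
Proof.
pose f (v : H) : R^o := dot v w.
have flin : linear f by move=> a u v; rewrite /f dotDl dotZl.
pose g : {linear H -> R^o} := HB.pack f (GRing.isLinear.Build R H R^o _ f flin).
move=> /(_ g); apply => v.
by apply: (cvg_dotl dot_norm); exact: cvg_id.
Qed.

(** With [p] the projection of [z], the variational inequality for the [y n] passes to the weak
    limit and gives [dot (z - p) (z - p) <= 0]. *)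
Lemma weakly_closed_convex (C : set H) (y : nat -> H) (z : H) :
  closed C -> convex_set (C : set (convex_lmodType H)) ->
  (forall n, C (y n)) -> weakly_cvg y z -> C z.
Proof.
move=> Ccl Ccv Cy yz.
have [Cp pP] := metric_projP dot_norm z (ex_intro _ _ (Cy 0%N)) Ccl Ccv.
set p := metric_proj C z in Cp pP.
suff -> : z = p by [].
apply/eqP; rewrite -subr_eq0; apply/eqP/(dot_eq0 dot_norm)/eqP.
rewrite eq_le dot_ge0// andbT {1}dotDl dotNl subr_le0.
apply: (@ler_cvg_to _ (nbhs \oo) _ R (fun n => dot (y n) (z - p))
  (fun=> dot p (z - p))); [exact: weakly_cvg_dot|exact: cvg_cst|].
apply: nearW => n; rewrite -subr_le0 -dotNl -dotDl dotC; exact: pP.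
Qed.

(** For fixed [x], being no farther from [T x] than from [x] is a half-space condition on [z];
    taking [x = z] forces [T z = z]. Closedness and convexity of the fixed point set both follow. *)
Lemma fixed_points_halfspaces (C : set H) (T : H -> H) :
  quasinonexpansive C T ->
  fixed_points C T = C `&` \bigcap_(x in C)
    [set z | dot z (x - T x) <= (dot x x - dot (T x) (T x)) / 2].
Proof.
move=> [_ qT].
have E x z : (dot z (x - T x) <= (dot x x - dot (T x) (T x)) / 2) =
    (`|T x - z| <= `|x - z|).
  rewrite -(ler_dot_norm dot_norm) !dotE (dotC _ (T x) z) (dotC _ x z).
  by apply/idP/idP; lra.
apply/seteqP; split => [z [Cz Tz]|z [Cz zP]].
  by split=> // x Cx /=; rewrite E; apply: qT.
split=> //; apply/eqP; rewrite -subr_eq0 -normr_le0.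
by have := zP _ Cz; rewrite /= E subrr normr0.
Qed.

Lemma closed_fixed_points (C : set H) (T : H -> H) :
  closed C -> quasinonexpansive C T -> closed (fixed_points C T).
Proof.
move=> Ccl /fixed_points_halfspaces ->; apply: closedI => //.
by apply: closed_bigI => x _; exact: (closed_halfspace dot_norm).
Qed.

Lemma convex_fixed_points (C : set H) (T : H -> H) :
  convex_set (C : set (convex_lmodType H)) -> quasinonexpansive C T ->
  convex_set (fixed_points C T : set (convex_lmodType H)).
Proof.
move=> Ccv /fixed_points_halfspaces -> p q t; rewrite !inE.
move=> [Cp pP] [Cq qP]; split.
  by have := Ccv p q t; rewrite !inE; apply.
move=> x Cx /=; have := pP _ Cx; have := qP _ Cx => /=.
set c := _ / 2; rewrite dotDl !dotZl => h1 h2.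
have -> : c = t%:num * c + (1 - t%:num) * c by ring.
by apply: lerD; rewrite ler_wpM2l// subr_ge0.
Qed.

(** One weakly convergent subsequence serves all [T j]: every residual vanishes along it, so its
    limit is an asymptotic fixed point of each. *)
Lemma asymptotic_subsequence (C : set H) (I : Type) (T : I -> H -> H)
    (x : nat -> H) (M : R) :
  (forall j, asymptotic_fixed_points C (T j) = fixed_points C (T j)) ->
  closed C -> convex_set (C : set (convex_lmodType H)) ->
  (forall n, C (x n)) -> (forall n, `|x n| <= M) ->
  (forall j, x n - T j (x n) @[n --> \oo] --> (0 : H)) ->
  exists (phi : nat -> nat) (v : H), [/\ forall k, (k <= phi k)%N,
    forall j, fixed_points C (T j) v & weakly_cvg (x \o phi) v].
Proof.
move=> asT Ccl Ccv Cx xM xT.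
have [phi [v [phi_ge xv]]] := bounded_weak_subsequence dot_norm xM.
exists phi, v; split=> // j; rewrite -asT; split.
  exact: (weakly_closed_convex Ccl Ccv (fun n => Cx (phi n)) xv).
exists (x \o phi); split=> //=.
apply: (cvg_comp phi _ _ (xT j)).
move=> A [N _ NA]; exists N => // k /= Nk.
by apply: NA; apply: leq_trans (phi_ge k).
Qed.

End WeakLimits.

(** * A real recursion that forces convergence to zero *)

Section Recursion.
Context (R : realType).

(** From [K] on, [step] pulls [s] towards [e]: divergence of the series brings [s] down to [2 * e]
    at some index, and each later value is bounded by a convex combination that keeps it there. *)
Lemma cvg0_recursion (s a t : nat -> R) (M : R) :
  (forall n, 0 <= s n <= M) -> (forall n, 0 < a n <= 1) ->
  series a @ \oo --> +oo -> a @ \oo --> (0 : R) ->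
  (forall n, s n.+1 <= (1 - a n) * s n + a n * t n) ->
  (forall e, 0 < e -> exists2 d, 0 < d &
    \forall n \near \oo, s n - s n.+1 <= d -> t n <= e) ->
  s @ \oo --> (0 : R).
Proof.
move=> sM a01 asum alim srec tP; apply/cvgr0Pnorm_le => e2 e20.
pose e := e2 / 2; have e0 : 0 < e by rewrite divr_gt0.
have M0 : 0 <= M by have /andP[] := sM 0%N; exact: le_trans.
have [d d0 [N1 _ N1P]] := tP e e0.
(* This makes [a n * s n < d], so a drop of [s] by more than [d] already exceeds what [step]
   asks. *)
have [|N2 _ N2P] := cvgr0_norm_lt _ alim (d / (M + 1)).
  by rewrite divr_gt0// ltr_wpDl.
pose K := maxn N1 N2.
have step n : (K <= n)%N -> s n.+1 <= s n - a n * (s n - e).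
  rewrite geq_max => /andP[n1 n2].
  have := N2P _ n2; have /andP[an0 an1] := a01 n.
  rewrite /= gtr0_norm// ltr_pdivlMr ?ltr_wpDl// => anM.
  have /andP[sn0 snM] := sM n.
  have [le_d|gt_d] := leP (s n - s n.+1) d.
    by have := N1P _ n1 le_d; have := srec n; nra.
  by nra.
have [m Km sm] : exists2 m, (K <= m)%N & s m <= 2 * e.
  apply: contrapT => /forall2NP noM.
  have big m : (K <= m)%N -> 2 * e < s m.
    by move=> Km; have [//|/negP] := noM m; rewrite -ltNge.
  have bound k : s (K + k)%N <= s K - e * (series a (K + k)%N - series a K).
    elim: k => [|k IH]; first by rewrite addn0 subrr mulr0 subr0.
    rewrite addnS seriesSr.
    have Kk : (K <= K + k)%N by rewrite leq_addr.
    have := step _ Kk; have := big _ Kk; have /andP[] := a01 (K + k)%N.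
    by nra.
  (* Such a growth of the partial sums would lower [s] by at least [M + e], hence below zero. *)
  have [N3 _ N3P] : \forall n \near \oo, series a K + M / e + 1 <= series a n.
    by move/cvgryPge: asum; apply.
  have := N3P (K + N3)%N (leq_addl _ _); have := bound N3.
  have /andP[sK0 _] := sM (K + N3)%N; have /andP[_ sKM] := sM K.
  move=> /= h1 h2.
  have : e * (M / e + 1) <= e * (series a (K + N3)%N - series a K).
    by rewrite ler_pM2l//; lra.
  by rewrite mulrDr mulrCA divff ?gt_eqF// mulr1; lra.
exists m => // n /= mn; have /andP[sn0 _] := sM n; rewrite ger0_norm//.
have -> : e2 = 2 * e by rewrite /e; lra.
rewrite -(subnKC mn); elim: (n - m)%N => [|k IH]; first by rewrite addn0.
rewrite addnS; have Kk : (K <= m + k)%N by rewrite (leq_trans Km)// leq_addr.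
by have := step _ Kk; have /andP[] := a01 (m + k)%N; nra.
Qed.

End Recursion.

(** * Estimates for one Halpern step *)

Section OneStep.
Context (R : realType) (H : normedModType R) (dot : {dot H for idfun}).
Hypothesis dot_norm : forall v : H, `|v| ^+ 2 = dot v v.
Implicit Types (a b : R) (u v x p : H).

Lemma combinationB a u v p :
  a *: u + (1 - a) *: v - p = a *: (u - p) + (1 - a) *: (v - p).
Proof.
rewrite !scalerBr addrACA -opprD -scalerDl.
by rewrite [a + _]addrC subrK scale1r.
Qed.

Lemma norm_combination a u v : 0 <= a <= 1 ->
  `|a *: u + (1 - a) *: v| <= a * `|u| + (1 - a) * `|v|.
Proof.
move=> /andP[a0 a1]; apply: le_trans (ler_normD _ _) _.
by rewrite !normrZ !ger0_norm// subr_ge0.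
Qed.

Lemma halpern_step_bounded a b u x v p K : 0 <= a <= 1 -> 0 <= b <= 1 ->
  `|u - p| <= K -> `|x - p| <= K -> `|v - p| <= K ->
  `|a *: u + (1 - a) *: (b *: x + (1 - b) *: v) - p| <= K.
Proof.
move=> a01 b01 uK xK vK; rewrite combinationB.
apply: le_trans (norm_combination _ _ a01) _.
have wK : `|b *: x + (1 - b) *: v - p| <= K.
  rewrite combinationB; apply: le_trans (norm_combination _ _ b01) _.
  by move/andP: b01 => [b0 b1]; nra.
by move/andP: a01 => [a0 a1]; nra.
Qed.

(** Rests on [|r + q|^2 <= |q|^2 + 2 <r, r + q>] with [r = a *: (u - p)], on [(1 - a)^2 <= 1 - a],
    and on [dot_combination] for the inner average. *)
Lemma halpern_step a b u x v p :
  let y := a *: u + (1 - a) *: (b *: x + (1 - b) *: v) in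
  0 <= a <= 1 -> 0 <= b <= 1 -> `|v - p| <= `|x - p| ->
  `|y - p| ^+ 2 <= (1 - a) * `|x - p| ^+ 2
    - (1 - a) * (b * (1 - b) * `|v - x| ^+ 2) + a * (2 * dot (u - p) (y - p)).
Proof.
move=> y /andP[a0 a1] /andP[b0 b1]; rewrite -(ler_dot_norm dot_norm) !dot_norm.
rewrite /y !combinationB.
have -> : v - x = (v - p) - (x - p) by rewrite opprB addrA subrK.
move: (u - p) (x - p) (v - p) => {y} u' x' v' vx.
have := dot_combination dot b x' v'.
have -> : dot (x' - v') (x' - v') = dot (v' - x') (v' - x').
  by rewrite -opprB dotNl dotNr opprK.
move: (b *: x' + (1 - b) *: v') (dot (v' - x') (v' - x')) => w d wE.
have uu := dot_ge0 dot_norm u'; have ww := dot_ge0 dot_norm w.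
have wle : dot w w <= dot x' x' - b * (1 - b) * d by rewrite wE; nra.
have a1' : 0 <= 1 - a by rewrite subr_ge0.
have := ler_wpM2l a1' wle; have := mulr_ge0 (mulr_ge0 a0 a1') ww.
have := mulr_ge0 (mulr_ge0 a0 a0) uu.
by rewrite !dotE (dotC _ w u'); lra.
Qed.

End OneStep.

(** * Strong convergence of the projected Halpern iteration *)

Theorem theorem3p1 (R : realType)
  (* real Hilbert space: complete, with the norm given by an inner product *)
  (H : completeNormedModType R) (dot : {dot H for idfun})
  (dot_norm : forall v : H, `|v| ^+ 2 = dot v v)
  (C : set H) (C_neq0 : C !=set0) (C_closed : closed C)
  (C_convex : convex_set (C : set (convex_lmodType H)))
  (N : nat) (N_gt0 : (0 < N)%N) (T : 'I_N -> H -> H)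
  (T_qne : forall i, quasinonexpansive C (T i))
  (F : set H) (F_def : F = \bigcap_(i in [set: 'I_N]) fixed_points C (T i))
  (u : H) (alpha beta : nat -> R)
  (alpha_itv : forall n, 0 < alpha n <= 1)
  (beta_itv : forall n, 0 < beta n < 1)
  (x : nat -> H) (i : nat -> 'I_N)
  (x0_C : C (x 0%N))
  (i_argmax : forall n, argmax (fun j : 'I_N => `|T j (x n) - x n|) (i n))
  (x_rec : forall n, x n.+1 =
     metric_proj C (alpha n *: u + (1 - alpha n) *:
                      (beta n *: x n + (1 - beta n) *: T (i n) (x n))))
  (F_neq0 : F !=set0)
  (T_asymp : forall j, asymptotic_fixed_points C (T j) = fixed_points C (T j))
  (alpha_sum : series alpha @ \oo --> +oo)
  (alpha_lim : alpha @ \oo --> (0 : R))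
  (beta_inf : 0 < inf (range beta))
  (beta_sup : sup (range beta) < 1) :
  x @ \oo --> metric_proj F u.
Proof.
have F_sub p : F p -> C p /\ forall j, T j p = p.
  rewrite F_def => Fp; split=> [|j]; last by case: (Fp j I).
  by case: (Fp (Ordinal N_gt0) I).
have F_closed : closed F.
  rewrite F_def; apply: closed_bigI => j _.
  exact: (closed_fixed_points dot_norm).
have F_convex : convex_set (F : set (convex_lmodType H)).
  move=> p q t; rewrite !inE F_def => Fp Fq j _.
  have := convex_fixed_points dot_norm C_convex (T_qne j) (x := p) (y := q) t.
  by rewrite !inE; apply; [exact: Fp|exact: Fq].
have [Fz zP] := metric_projP dot_norm u F_neq0 F_closed F_convex.
set z := metric_proj F u in Fz zP *.
have [Cz Tz] := F_sub _ Fz.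
pose y n := alpha n *: u + (1 - alpha n) *:
  (beta n *: x n + (1 - beta n) *: T (i n) (x n)).
have a01 n : 0 <= alpha n <= 1.
  by have /andP[/ltW -> ->] := alpha_itv n.
have b01 n : 0 <= beta n <= 1.
  by have /andP[/ltW -> /ltW ->] := beta_itv n.
have xC n : C (x n).
  case: n => [//|n]; rewrite x_rec.
  by have [] := metric_projP dot_norm (y n) C_neq0 C_closed C_convex.
have Tdist n : `|T (i n) (x n) - z| <= `|x n - z|.
  by apply: (T_qne (i n)).2 => //; split.
have xy n : `|x n.+1 - z| <= `|y n - z|.
  by rewrite x_rec; apply: (metric_proj_dist dot_norm).
(* The ball of radius [B] around [z] contains [u] and the starting point, and the iteration never
   leaves it. *)
pose B := Num.max `|u - z| `|x 0%N - z|.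
have uB : `|u - z| <= B by rewrite /B le_max lexx.
have xB n : `|x n - z| <= B.
  elim: n => [|n IH]; first by rewrite /B le_max lexx orbT.
  apply: le_trans (xy n) _.
  by apply: halpern_step_bounded => //; exact: le_trans (Tdist n) IH.
have yB n : `|y n - z| <= B.
  by apply: halpern_step_bounded => //; exact: le_trans (Tdist n) (xB n).
have B0 : 0 <= B by exact: le_trans uB.
pose s n := `|x n - z| ^+ 2.
pose t n := 2 * dot (u - z) (y n - z).
pose D n := `|T (i n) (x n) - x n|.
have tB n : t n <= 2 * B ^+ 2.
  rewrite /t ler_pM2l//; apply: le_trans (ler_norm _) _.
  by apply: le_trans (dot_normM dot_norm _ _) _; rewrite expr2 ler_pM.
have srec n : s n.+1 <= (1 - alpha n) * s n
    - (1 - alpha n) * (beta n * (1 - beta n) * D n ^+ 2) + alpha n * t n.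
  apply: le_trans (halpern_step dot_norm u (a01 n) (b01 n) (Tdist n)).
  by rewrite /s ler_sqr ?nnegrE//; exact: xy.
have [c c0 cP] : exists2 c, 0 < c & forall n, c <= beta n * (1 - beta n).
  exists (inf (range beta) * (1 - sup (range beta))).
    by rewrite mulr_gt0// subr_gt0.
  move=> n; apply: ler_pM; [exact: ltW|by rewrite subr_ge0 ltW| |].
    by apply: ge_inf; [exists 0 => _ [k _ <-]; have /andP[] := b01 k|exists n].
  rewrite lerD2l lerN2; apply: ub_le_sup; last by exists n.
  by exists 1 => _ [k _ <-]; have /andP[] := b01 k.
suff s0 : s @ \oo --> (0 : R).
  apply/cvgrPdistC_lt => e e0.
  have e2 : 0 < e ^+ 2 by rewrite exprn_gt0.
  near=> n; have : `|s n| < e ^+ 2 by near: n; exact: (cvgr0_norm_lt _ s0).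
  by rewrite /s ger0_norm ?exprn_ge0// ltr_sqr ?nnegrE// ltW.
apply: (@cvg0_recursion R s alpha t (B ^+ 2)) => //.
- by move=> n; rewrite /s exprn_ge0//= ler_sqr ?nnegrE.
- move=> n; apply: le_trans (srec n) _; rewrite lerD2r gerBl.
  have /andP[_ a1] := a01 n; apply: mulr_ge0; first by rewrite subr_ge0.
  by apply: mulr_ge0; [exact: le_trans (ltW c0) (cP n)|exact: sqr_ge0].
move=> e e0; apply: contrapT => /forall2NP noD.
(* Negating the claim with [d = 1 / (k + 1)] yields bad indices beyond every [k]. The map [phi] may
   fail to be monotone; [k <= phi k] suffices for limits. *)
have /choice[phi phiP] k : exists n, [/\ (k <= n)%N,
    s n - s n.+1 <= k.+1%:R^-1 & e < t n].
  have [/negP|no] := noD k.+1%:R^-1; first by rewrite invr_gt0 ltr0n.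
  apply: contrapT => /forallNP nok; apply: no; exists k => // n /= kn sn.
  by rewrite leNgt; apply/negP => etn; apply: (nok n).
have phi_oo (f : nat -> nat) : (forall k, (k <= f k)%N) -> f @ \oo --> \oo.
  move=> f_ge A [m _ mA]; exists m => // k /= mk.
  by apply: mA => /=; apply: leq_trans (f_ge k).
have aphi0 : alpha (phi k) @[k --> \oo] --> (0 : R).
  by apply: (cvg_comp phi alpha (phi_oo _ _) alpha_lim) => k; case: (phiP k).
have Dphi0 : D (phi k) @[k --> \oo] --> (0 : R).
  apply/cvgr0Pnorm_lt => r r0.
  (* In [srec], the drop of [s] and [a * t] each contribute less than [c * r ^+ 2 / 4]; since
     [1 - a > 1 / 2], this gives [c * D ^+ 2 < c * r ^+ 2]. *)
  have r1 : 0 < c * r ^+ 2 / 4 by rewrite !mulr_gt0 ?invr_gt0 ?exprn_gt0.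
  have B1 : 0 < 2 * B ^+ 2 + 1 by rewrite ltr_wpDl// mulr_ge0// exprn_ge0.
  near=> k.
  have [_ sk _] := phiP k.
  have ak : `|alpha (phi k)| < 2^-1.
    by near: k; apply: (cvgr0_norm_lt _ aphi0); rewrite invr_gt0.
  have ak2 : `|alpha (phi k)| < c * r ^+ 2 / 4 / (2 * B ^+ 2 + 1).
    by near: k; apply: (cvgr0_norm_lt _ aphi0); rewrite divr_gt0.
  have k1 : k.+1%:R^-1 < c * r ^+ 2 / 4.
    by near: k; exact: (near_infty_natSinv_lt (PosNum r1)).
  have /andP[a0 _] := alpha_itv (phi k).
  rewrite gtr0_norm// in ak; rewrite gtr0_norm// ltr_pdivlMr// in ak2.
  rewrite ger0_norm ?normr_ge0// -ltr_sqr ?nnegrE ?normr_ge0//; last exact: ltW.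
  have cED := ler_wpM2r (sqr_ge0 (D (phi k))) (cP (phi k)).
  have := le_trans (mulr_ge0 (ltW c0) (sqr_ge0 (D (phi k)))) cED; move: cED.
  have := srec (phi k); have := ler_wpM2l (ltW a0) (tB (phi k)).
  have := sqr_ge0 `|x (phi k) - z|; rewrite -/(s _) => sk0.
  move: k.+1%:R^-1 (alpha _) (s _) (s _) (t _) (beta _ * _) (D _ ^+ 2) sk ak ak2
    k1 a0 sk0 => h a s1 s2 t1 E D2 sk ak ak2 k1 a0 sk0 at1 srec1 cED ED0.
  rewrite -(ltr_pM2l c0); nra.
have Tphi0 j : x (phi k) - T j (x (phi k)) @[k --> \oo] --> (0 : H).
  apply/cvgr0Pnorm_lt => r r0; near=> k.
  rewrite distrC; apply: le_lt_trans (i_argmax _ j) _.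
  rewrite -[ltLHS]ger0_norm//; near: k; exact: (cvgr0_norm_lt _ Dphi0).
have xphiB k : `|x (phi k)| <= B + `|z|.
  by rewrite -[x _](subrK z); apply: le_trans (ler_normD _ _) _; rewrite lerD2r.
have [psi [v [psi_ge Fv xv]]] := asymptotic_subsequence dot_norm
  (x := x \o phi) T_asymp C_closed C_convex (fun k => xC (phi k)) xphiB Tphi0.
have /zP : F v by rewrite F_def.
pose th := phi \o psi.
(* The weak limit concerns [x], whereas [t] involves [y]; the cost of the exchange is governed by
   [alpha n] and [D n], both vanishing along [th]. *)
have tupper n : t n <= 2 * dot (x n - z) (u - z) +
    2 * B * (alpha n * (2 * B) + D n).
  have xuB : `|u - x n| <= 2 * B.
    rewrite -(subrK z u) -addrA -(opprB (x n)).
    by have := ler_normB (u - z) (x n - z); have := xB n; lra.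
  have yx : `|y n - x n| <= alpha n * (2 * B) + D n.
    rewrite combinationB; apply: le_trans (norm_combination _ _ (a01 n)) _.
    have /andP[a0 a1] := a01 n; apply: lerD; first exact: ler_wpM2l.
    apply: (@le_trans _ _ (1 * D n)); last by rewrite mul1r.
    apply: ler_pM; rewrite ?subr_ge0// ?gerBl//.
    rewrite combinationB subrr scaler0 add0r normrZ.
    have /andP[b0 b1] := b01 n.
    by rewrite ger0_norm ?subr_ge0// ler_piMl// gerBl.
  have -> : t n = 2 * dot (x n - z) (u - z) + 2 * dot (u - z) (y n - x n).
    by rewrite /t (dotC _ (x n - z)) -mulrDr -dotDr [x n - z + _]addrC subrKA.
  rewrite lerD2l -mulrA ler_pM2l//; apply: le_trans (ler_norm _) _.
  by apply: le_trans (dot_normM dot_norm _ _) _; exact: ler_pM.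
(* The variational inequality at [v] makes the right side nonpositive, against [0 < e]. *)
suff : e <= 2 * dot (v - z) (u - z) by rewrite (dotC _ (v - z)); lra.
apply: (@ler_cvg_to _ (nbhs \oo) _ R (fun=> e) (fun k =>
  2 * dot (x (th k) - z) (u - z) +
  2 * B * (alpha (th k) * (2 * B) + D (th k)))).
- exact: cvg_cst.
- have Dth0 := cvg_comp psi _ (phi_oo _ psi_ge) Dphi0.
  have ath0 := cvg_comp psi _ (phi_oo _ psi_ge) aphi0.
  have lim0 : 2 * B * (alpha (th k) * (2 * B) + D (th k)) @[k --> \oo] -->
      2 * B * (0 * (2 * B) + 0).
    by apply: cvgMr; apply: cvgD => //; exact: cvgMl.
  have lim1 : 2 * dot (x (th k) - z) (u - z) @[k --> \oo] -->
      2 * dot (v - z) (u - z).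
    apply: cvgMr; rewrite dotDl dotNl; under eq_fun do rewrite dotDl dotNl.
    by apply: cvgB; [exact: weakly_cvg_dot xv|exact: cvg_cst].
  rewrite mul0r addr0 mulr0 in lim0.
  by rewrite -[2 * dot (v - z) _]addr0; exact: (cvgD lim1 lim0).
- apply: nearW => k; apply: le_trans (tupper _); apply: ltW.
  by case: (phiP (psi k)).
Unshelve. all: by end_near. Qed.
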